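(* Let $\mathbf{K}_x,\mathbf{M}_x\in\mathbb{R}^{m\times m}$ be symmetric and positive (definite) matrices, and let $\alpha,\beta$ be real numbers with $\alpha>0$. Define the block matrices in $\mathbb{R}^{2m\times 2m}$ $$\overline{A} := \begin{bmatrix}\mathbf{K}_x+\alpha\mathbf{M}_x & \beta\mathbf{M}_x\\ \beta\mathbf{M}_x & -(\mathbf{K}_x+\alpha\mathbf{M}_x)\end{bmatrix},\qquad P := \begin{bmatrix}\mathbf{K}_x+(\alpha+|\beta|)\mathbf{M}_x & 0\\ 0 & \mathbf{K}_x+(\alpha+|\beta|)\mathbf{M}_x\end{bmatrix}.$$ Then the condition number estimate $$\mathrm{cond}_P(P^{-1}\overline{A})\le \sqrt{2}\,\frac{\sqrt{5}+1}{\sqrt{5}-1}$$ holds.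
   Context: A real square matrix $B$ is called positive if $v^TBv>0$ for all real vectors $v\neq 0$. For a symmetric positive definite matrix $P$, $\|u\|_P=(u^TPu)^{1/2}$, the same symbol $\|\cdot\|_P$ denotes the induced operator norm on matrices, and $\mathrm{cond}_P(P^{-1}\overline{A}) := \|P^{-1}\overline{A}\|_P\,\|\overline{A}^{-1}P\|_P$. *)

(* Defs.v *)
From mathcomp Require Import all_boot all_order all_algebra.
From mathcomp Require Import classical_sets reals ring.

Set Implicit Arguments.
Unset Strict Implicit.
Unset Printing Implicit Defensive.

Import Order.TTheory GRing.Theory Num.Theory.

Local Open Scope classical_set_scope.
Local Open Scope ring_scope.

Definition bilin (R : realType) (n : nat) (B : 'M[R]_n) (u v : 'cV[R]_n) : R :=
  (u^T *m B *m v) 0 0.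

(* Symmetry is not part of positivity. *)
Definition positivemx (R : realType) (n : nat) (B : 'M[R]_n) : Prop :=
  forall v : 'cV[R]_n, v != 0 -> 0 < bilin B v v.

Definition normP (R : realType) (n : nat) (P : 'M[R]_n) (u : 'cV[R]_n) : R :=
  Num.sqrt (bilin P u u).

(* The set is bounded when P is symmetric positive (opnorm_has_ubound below),
   so the default value of [sup] on unbounded sets plays no role.  It is empty
   only for n = 0, where the norm is 0. *)
Definition opnorm (R : realType) (n : nat) (P B : 'M[R]_n) : R :=
  sup [set normP P (B *m u) / normP P u | u in [set u : 'cV[R]_n | u != 0]].

(* cond_P (P^-1 A); note that the arguments are P and A, not P^-1 A. *)
Definition condP (R : realType) (n : nat) (P A : 'M[R]_n) : R :=
  opnorm P (invmx P *m A) * opnorm P (invmx A *m P).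

Definition Abar (R : realType) (m : nat) (Kx Mx : 'M[R]_m) (alpha beta : R) :
    'M[R]_(m + m) :=
  block_mx (Kx + alpha *: Mx) (beta *: Mx)
           (beta *: Mx)       (- (Kx + alpha *: Mx)).

Definition Pbar (R : realType) (m : nat) (Kx Mx : 'M[R]_m) (alpha beta : R) :
    'M[R]_(m + m) :=
  block_mx (Kx + (alpha + `|beta|) *: Mx) 0
           0 (Kx + (alpha + `|beta|) *: Mx).

Section Bilin.
Context {R : realType} {n : nat}.
Implicit Types (B P : 'M[R]_n) (u v w : 'cV[R]_n).

Lemma bilinDl B u v w : bilin B (u + v) w = bilin B u w + bilin B v w.
Proof. by rewrite /bilin linearD /= !mulmxDl mxE. Qed.

Lemma bilinDr B u v w : bilin B u (v + w) = bilin B u v + bilin B u w.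
Proof. by rewrite /bilin mulmxDr mxE. Qed.

Lemma bilinZl B a u v : bilin B (a *: u) v = a * bilin B u v.
Proof. by rewrite /bilin linearZ /= -!scalemxAl mxE. Qed.

Lemma bilinZr B a u v : bilin B u (a *: v) = a * bilin B u v.
Proof. by rewrite /bilin -scalemxAr mxE. Qed.

Lemma bilin0r B u : bilin B u 0 = 0.
Proof. by rewrite /bilin mulmx0 mxE. Qed.

Lemma bilinC B u v : B^T = B -> bilin B u v = bilin B v u.
Proof.
move=> sB; rewrite /bilin; have -> : (u^T *m B *m v) = (v^T *m B *m u)^T.
  by rewrite !trmx_mul trmxK sB mulmxA.
by rewrite mxE.
Qed.

Lemma positivemx_ge0 B v : positivemx B -> 0 <= bilin B v v.
Proof.
move=> pB; have [->|/pB/ltW //] := eqVneq v 0.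
by rewrite bilin0r.
Qed.

Lemma unitmx_inj B : (forall v, B *m v = 0 -> v = 0) -> B \in unitmx.
Proof.
move=> injB; rewrite -unitmx_tr -row_free_unit; apply: inj_row_free => v vB0.
apply: (can_inj trmxK); rewrite trmx0; apply: injB.
by rewrite -[B]trmxK -trmx_mul vB0 trmx0.
Qed.

Lemma positivemx_unit B : positivemx B -> B \in unitmx.
Proof.
move=> pB; apply: unitmx_inj => v Bv0; apply/eqP; apply: contraT => /pB.
by rewrite /bilin -mulmxA Bv0 mulmx0 mxE ltxx.
Qed.

Lemma bilin_CauchySchwarz P u v : P^T = P -> positivemx P ->
  bilin P u v ^+ 2 <= bilin P u u * bilin P v v.
Proof.
move=> sP pP; have [->|v0] := eqVneq v 0.
  by rewrite !bilin0r expr0n mulr0.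
have := positivemx_ge0 (bilin P v v *: u + (- bilin P u v) *: v) pP.
rewrite !(bilinDl, bilinDr, bilinZl, bilinZr) (bilinC v u sP).
set a := bilin P v v; set b := bilin P u v; set c := bilin P u u.
have a0 : 0 < a by exact: pP.
rewrite (_ : _ + _ = a * (c * a - b ^+ 2)); last by ring.
by rewrite pmulr_rge0// subr_ge0.
Qed.

Lemma normP_CauchySchwarz P u v : P^T = P -> positivemx P ->
  `|bilin P u v| <= normP P u * normP P v.
Proof.
move=> sP pP; rewrite /normP -sqrtrM ?positivemx_ge0// -sqrtr_sqr ler_sqrt.
  exact: bilin_CauchySchwarz.
by rewrite mulr_ge0// positivemx_ge0.
Qed.

Lemma normP0 P : normP P 0 = 0.
Proof. by rewrite /normP bilin0r sqrtr0. Qed.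

Lemma normP_gt0 P u : positivemx P -> u != 0 -> 0 < normP P u.
Proof. by move=> pP u0; rewrite sqrtr_gt0; exact: pP. Qed.

Lemma normPZ P a u : normP P (a *: u) = `|a| * normP P u.
Proof.
by rewrite /normP bilinZl bilinZr mulrA -expr2 sqrtrM ?sqr_ge0// sqrtr_sqr.
Qed.

Lemma ler_normPD P u v : P^T = P -> positivemx P ->
  normP P (u + v) <= normP P u + normP P v.
Proof.
move=> sP pP; rewrite -(@ler_pXn2r _ 2)// ?nnegrE ?addr_ge0 ?sqrtr_ge0//.
rewrite sqrrD !sqr_sqrtr ?positivemx_ge0// bilinDl !bilinDr (bilinC v u sP).
rewrite addrA lerD2r -addrA lerD2l -mulr2n lerMn2r /=.
by rewrite (le_trans (ler_norm _))// normP_CauchySchwarz.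
Qed.

Lemma opnorm_has_ubound P B : P^T = P -> positivemx P ->
  has_ubound
    [set normP P (B *m u) / normP P u | u in [set u : 'cV[R]_n | u != 0]].
Proof.
move=> sP pP; have uP := positivemx_unit pP.
pose e i : 'cV[R]_n := delta_mx i 0.
exists (\sum_i normP P (invmx P *m e i) * normP P (B *m e i)).
move=> _ [u /= u0 <-]; rewrite ler_pdivrMr ?normP_gt0//.
have {1}-> : u = \sum_i u i 0 *: e i.
  by rewrite {1}[u]matrix_sum_delta; apply: eq_bigr => i _; rewrite big_ord1.
rewrite mulmx_sumr mulr_suml.
elim/big_ind2 : _ => [|x a y b xa yb|i _]; first by rewrite normP0.
  by rewrite (le_trans (ler_normPD _ _ sP pP))// lerD.
rewrite -scalemxAr normPZ mulrAC ler_wpM2r ?sqrtr_ge0//.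
have -> : u i 0 = bilin P (invmx P *m e i) u.
  rewrite /bilin trmx_mul trmx_inv sP -!mulmxA mulKmx// /e trmx_delta.
  by rewrite -rowE mxE.
exact: normP_CauchySchwarz.
Qed.

Lemma normP_mulmx_le P B u : P^T = P -> positivemx P ->
  normP P (B *m u) <= opnorm P B * normP P u.
Proof.
move=> sP pP; have [->|u0] := eqVneq u 0; first by rewrite mulmx0 normP0 mulr0.
rewrite -ler_pdivrMr ?normP_gt0//; apply: ub_le_sup; last by exists u.
exact: opnorm_has_ubound.
Qed.

End Bilin.

Section Blocks.
Context {R : realType} {m : nat}.
Implicit Types (Kx Mx : 'M[R]_m) (alpha beta : R).

Lemma positivemxD_scale Kx Mx a : positivemx Kx -> positivemx Mx -> 0 <= a ->
  positivemx (Kx + a *: Mx).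
Proof.
move=> pK pM a0 v v0; rewrite /bilin mulmxDr mulmxDl mxE -scalemxAr -scalemxAl.
by rewrite [X in 0 < _ + X]mxE ltr_pwDl ?pK// mulr_ge0// ltW// pM.
Qed.

Lemma Pbar_sym Kx Mx alpha beta : Kx^T = Kx -> Mx^T = Mx ->
  (Pbar Kx Mx alpha beta)^T = Pbar Kx Mx alpha beta.
Proof.
by move=> sK sM; rewrite /Pbar tr_block_mx trmx0 linearD linearZ /= sK sM.
Qed.

Lemma Pbar_positive Kx Mx alpha beta :
  positivemx Kx -> positivemx Mx -> 0 < alpha ->
  positivemx (Pbar Kx Mx alpha beta).
Proof.
move=> pK pM a0 v; rewrite -[v]vsubmxK; set x := usubmx v; set y := dsubmx v.
rewrite col_mx_eq0 negb_and /bilin tr_col_mx mul_row_block !mulmx0 addr0 add0r.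
rewrite mul_row_col mxE.
have pH : positivemx (Kx + (alpha + `|beta|) *: Mx).
  by apply: positivemxD_scale; rewrite // addr_ge0// ltW.
have x0 := positivemx_ge0 x pH; have y0 := positivemx_ge0 y pH.
by case/orP => /pH h; [rewrite ltr_pwDl|rewrite ltr_wpDl].
Qed.

(* The inverse in [condP] is a genuine one for the matrices considered. *)
Lemma Abar_unit Kx Mx alpha beta : Mx^T = Mx ->
  positivemx Kx -> positivemx Mx -> 0 < alpha ->
  Abar Kx Mx alpha beta \in unitmx.
Proof.
move=> sM pK pM a0; apply: unitmx_inj => v.
rewrite -[v]vsubmxK; set x := usubmx v; set y := dsubmx v.
have pH : positivemx (Kx + alpha *: Mx) by apply: positivemxD_scale => //; exact: ltW.
rewrite /Abar mul_block_col; set H := Kx + alpha *: Mx in pH *.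
move/eqP; rewrite col_mx_eq0 => /andP[/eqP e1 /eqP e2].
have {}e1 : bilin H x x + beta * bilin Mx x y = 0.
  have h := congr1 (fun z => (x^T *m z) 0 0) e1; move: h => /=.
  rewrite mulmxDr mulmx0 -scalemxAl -scalemxAr !mulmxA => h.
  by rewrite mxE [X in _ + X = _]mxE [RHS]mxE in h.
have {}e2 : beta * bilin Mx x y - bilin H y y = 0.
  have h := congr1 (fun z => (y^T *m z) 0 0) e2; move: h => /=.
  rewrite mulmxDr mulmx0 mulNmx mulmxN -scalemxAl -scalemxAr !mulmxA => h.
  rewrite mxE [X in X + _ = _]mxE [X in _ + X = _]mxE [RHS]mxE in h.
  by rewrite (bilinC x y sM).
have xy0 : bilin H x x + bilin H y y = 0.
  move/eqP : e2; rewrite subr_eq0 => /eqP <-; exact: e1.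
have x0 := positivemx_ge0 x pH; have y0 := positivemx_ge0 y pH.
move/eqP : xy0; rewrite paddr_eq0// => /andP[qx qy].
have z w : bilin H w w == 0 -> w = 0.
  by move=> qw; apply/eqP; apply: contraLR qw => /pH; rewrite lt0r => /andP[].
by rewrite (z _ qx) (z _ qy) col_mx0.
Qed.

End Blocks.

(* Main.v *)
(** Put [H = K + alpha M] and let [s] be a sign with [s beta = |beta|], so that
    [P] is two copies of [H + |beta| M].  Completing squares in the forms of [H]
    and [M] gives [2 w^T A u <= |w|_P^2 + |u|_P^2]; for [w = P^-1 A u] this is
    [|P^-1 A u|_P <= |u|_P].  Conversely, for [u = (x, y)] the test vector
    [v = (x + s y, s x - y)] satisfies [v^T A u = |u|_P^2] and
    [|v|_P^2 = 2 |u|_P^2], so [|A^-1 P|_P <= sqrt 2].  Hence even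
    [cond_P (P^-1 A) <= sqrt 2]. *)

Require Import Defs.
From mathcomp Require Import all_boot all_order all_algebra.
From mathcomp Require Import classical_sets reals.
From mathcomp Require Import boolp ring lra.

Import Order.TTheory GRing.Theory Num.Theory.
Local Open Scope ring_scope.

Section BilinMatrix.
Context {R : realType} {n : nat}.
Implicit Types (A B P : 'M[R]_n) (u v : 'cV[R]_n).

Lemma bilinDm A B u v : bilin (A + B) u v = bilin A u v + bilin B u v.
Proof. by rewrite /bilin mulmxDr mulmxDl mxE. Qed.

Lemma bilinZm a A u v : bilin (a *: A) u v = a * bilin A u v.
Proof. by rewrite /bilin -scalemxAr -scalemxAl mxE. Qed.

Lemma bilinNm A u v : bilin (- A) u v = - bilin A u v.
Proof. by rewrite /bilin mulmxN mulNmx mxE. Qed.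

Lemma bilin0m u v : bilin 0 u v = 0.
Proof. by rewrite /bilin mulmx0 mul0mx mxE. Qed.

Lemma bilin_mulmxr A B u v : bilin A u (B *m v) = bilin (A *m B) u v.
Proof. by rewrite /bilin !mulmxA. Qed.

Lemma opnorm_le P B c : positivemx P -> 0 <= c ->
  (forall u, normP P (B *m u) <= c * normP P u) -> opnorm P B <= c.
Proof.
move=> pP c0 Bc; rewrite /opnorm; set S := (X in sup X).
(* For [n = 0] there is no nonzero vector and the supremum of the empty set is 0; here [0 <= c] is
   used. *)
have [->|/set0P S0] := eqVneq S set0; first by rewrite sup0.
apply: ge_sup => // _ [u /= u0 <-].
by rewrite ler_pdivrMr ?normP_gt0.
Qed.

Lemma opnorm_ge0 P B : 0 <= opnorm P B.
Proof.
rewrite /opnorm; set S := (X in sup X).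
have S_ge0 x : S x -> 0 <= x by move=> [u _ <-]; rewrite divr_ge0 ?sqrtr_ge0.
(* On an empty or unbounded set [sup] takes its default value 0. *)
have [supS|/sup_out-> //] := pselect (has_sup S).
have [[x Sx] ubS] := supS.
by apply: (le_trans (S_ge0 x Sx)); exact: ub_le_sup.
Qed.

End BilinMatrix.

Lemma bilin_block (R : realType) (m : nat) (A B C D : 'M[R]_m)
    (x y x' y' : 'cV[R]_m) :
  bilin (block_mx A B C D) (col_mx x y) (col_mx x' y') =
  bilin A x x' + bilin B x y' + bilin C y x' + bilin D y y'.
Proof.
rewrite /bilin tr_col_mx mul_row_block mul_row_col !mulmxDl !mxE.
by ring.
Qed.

Section Estimates.
Context {R : realType} {m : nat}.
Variables (K M : 'M[R]_m) (alpha beta : R).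
Hypotheses (sK : K^T = K) (pK : positivemx K).
Hypotheses (sM : M^T = M) (pM : positivemx M) (alpha_gt0 : 0 < alpha).

Let A := Abar K M alpha beta.
Let P := Pbar K M alpha beta.

Let sP : P^T = P. Proof. exact: Pbar_sym. Qed.
Let pP : positivemx P. Proof. exact: Pbar_positive. Qed.

Lemma bilin_Abar x y x' y' :
  bilin A (col_mx x y) (col_mx x' y') =
  bilin (K + alpha *: M) x x' + beta * bilin M x y' + beta * bilin M y x'
  - bilin (K + alpha *: M) y y'.
Proof. by rewrite bilin_block bilinNm !bilinZm. Qed.

Lemma bilin_Pbar x y x' y' :
  bilin P (col_mx x y) (col_mx x' y') =
  bilin (K + alpha *: M) x x' + `|beta| * bilin M x x'
  + (bilin (K + alpha *: M) y y' + `|beta| * bilin M y y').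
Proof.
by rewrite bilin_block !bilin0m !addr0 scalerDl addrA !(bilinDm _ (_ *: _)) !bilinZm.
Qed.

Let H := K + alpha *: M.
Let sH : H^T = H. Proof. by rewrite linearD linearZ /= sK sM. Qed.
Let pH : positivemx H. Proof. by apply: positivemxD_scale => //; exact: ltW. Qed.

(** The sign function is 0 at [beta = 0], whereas [s ^+ 2 = 1] must hold there too; [s = 1] is
    chosen in that case. *)
Lemma sign_norm : exists2 s : R, s ^+ 2 = 1 & beta = s * `|beta|.
Proof.
have [b0|b0] := ger0P beta; first by exists 1; rewrite ?expr1n ?mul1r.
by exists (-1); rewrite ?sqrrN ?expr1n ?mulrNN ?mul1r.
Qed.

Lemma bilin_Abar_le w u : 2 * bilin A w u <= bilin P w w + bilin P u u.
Proof.
rewrite -[w]vsubmxK -[u]vsubmxK.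
move: (usubmx w) (dsubmx w) (usubmx u) (dsubmx u) => x y x' y'.
rewrite bilin_Abar !bilin_Pbar -/H; have [s s2 ->] := sign_norm.
have -> : `|s * `|beta| | = `|beta|.
  by rewrite normrM normr_id; have /eqP := s2; rewrite sqrf_eq1 => /orP[]/eqP->;
    rewrite ?normrN normr1 mul1r.
set b := `|beta|; have b0 : 0 <= b by exact: normr_ge0.
(* The right side minus the left side is exactly the sum of the four nonnegative terms [h1] to
   [h4]. *)
have h1 := positivemx_ge0 (x + (-1) *: x') pH.
have h2 := positivemx_ge0 (y + y') pH.
have h3 := mulr_ge0 b0 (positivemx_ge0 (x + (- s) *: y') pM).
have h4 := mulr_ge0 b0 (positivemx_ge0 (y + (- s) *: x') pM).
move: h1 h2 h3 h4; rewrite !(bilinDl, bilinDr, bilinZl, bilinZr).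
rewrite (bilinC x' x sH) (bilinC y' y sH) (bilinC y' x sM) (bilinC x' y sM).
rewrite !(mulrA (- s) (- s)) mulrNN -expr2 s2.
by move=> h1 h2 h3 h4; lra.
Qed.

(** In both identities the mixed terms in [x] and [y] cancel by symmetry of [H] and [M]; in the
    first, [s * beta = |beta|] turns the remaining [M] terms into those of [P]. *)
Lemma Abar_inf_sup u :
  exists2 v, bilin A v u = bilin P u u & bilin P v v = 2 * bilin P u u.
Proof.
rewrite -[u]vsubmxK; move: (usubmx u) (dsubmx u) => x y.
have [s s2 bE] := sign_norm.
exists (col_mx (x + s *: y) (s *: x + (-1) *: y)).
  rewrite bilin_Abar bilin_Pbar -/H {1 2}bE.
  rewrite !(bilinDl, bilinZl) (bilinC y x sH) (bilinC y x sM).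
  by ring: s2.
rewrite !bilin_Pbar -/H !(bilinDl, bilinDr, bilinZl, bilinZr).
by rewrite (bilinC y x sH) (bilinC y x sM); ring: s2.
Qed.

Lemma opnorm_PinvA_le1 : opnorm P (invmx P *m A) <= 1.
Proof.
apply: opnorm_le => // u; rewrite mul1r ler_wsqrtr//.
set w := _ *m u; have := bilin_Abar_le w u.
(* Since [P w = A u], the bound becomes [2 |w|_P^2 <= |w|_P^2 + |u|_P^2]. *)
have -> : bilin A w u = bilin P w w.
  by rewrite [in RHS]/w bilin_mulmxr mulKVmx ?positivemx_unit.
by lra.
Qed.

Lemma opnorm_AinvP_le_sqrt2 : opnorm P (invmx A *m P) <= Num.sqrt 2.
Proof.
apply: opnorm_le; rewrite ?sqrtr_ge0// => w; set u := _ *m w.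
have [v Avu Pvv] := Abar_inf_sup u.
have Auw : bilin A v u = bilin P v w.
  by rewrite bilin_mulmxr mulKVmx ?Abar_unit.
rewrite /normP -sqrtrM// ler_wsqrtr//.
(* As [A u = P w], this reads [|u|_P^4 <= 2 |u|_P^2 |w|_P^2]; it remains to divide by [|u|_P^2] when
   that is nonzero. *)
have := bilin_CauchySchwarz v w sP pP.
rewrite -Auw Avu Pvv.
have [->|u0] := eqVneq (bilin P u u) 0.
  by move=> _; rewrite mulr_ge0// positivemx_ge0.
have {}u0 : 0 < bilin P u u by rewrite lt0r u0 positivemx_ge0.
by rewrite expr2 (mulrC 2) -mulrA ler_pM2l.
Qed.

End Estimates.

Theorem theorem3p2 (R : realType) (m : nat) (Kx Mx : 'M[R]_m) (alpha beta : R)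
    (Kx_sym : Kx^T = Kx) (Kx_pos : positivemx Kx)
    (Mx_sym : Mx^T = Mx) (Mx_pos : positivemx Mx)
    (alpha_gt0 : 0 < alpha) :
  condP (Pbar Kx Mx alpha beta) (Abar Kx Mx alpha beta)
    <= Num.sqrt 2 * ((Num.sqrt 5 + 1) / (Num.sqrt 5 - 1)).
Proof.
have sqrt5_gt1 : 1 < Num.sqrt 5 :> R by rewrite -[ltLHS]sqrtr1 ltr_sqrt ?ltr1n.
apply: (@le_trans _ _ (1 * Num.sqrt 2)).
  apply: ler_pM; [exact: opnorm_ge0|exact: opnorm_ge0| |].
    exact: opnorm_PinvA_le1.
  exact: opnorm_AinvP_le_sqrt2.
(* The quotient of [sqrt 5 + 1] by [sqrt 5 - 1] is at least 1. *)
rewrite mul1r ler_peMr ?sqrtr_ge0// ler_pdivlMr ?subr_gt0// mul1r.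
by lra.
Qed.
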